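(* Let $\ell\geq 0$ and let $b,x,y_1,\dots,y_\ell$ be integers. Then there exists a positive integer modulus $m$ such that the set of tuples $(n,k_1,\dots,k_\ell)$ of non-negative integers satisfying the congruence $$x^n-b\,y_1^{k_1}\cdots y_\ell^{k_\ell}\equiv 1 \pmod m \quad\text{or}\quad x^n-b\,y_1^{k_1}\cdots y_\ell^{k_\ell}\equiv -1 \pmod m$$ coincides with the set of tuples $(n,k_1,\dots,k_\ell)$ of non-negative integers satisfying the equation $$x^n-b\,y_1^{k_1}\cdots y_\ell^{k_\ell}=1 \quad\text{or}\quad x^n-b\,y_1^{k_1}\cdots y_\ell^{k_\ell}=-1.$$ (The same conclusion holds with the sign $\pm1$ fixed, i.e. for each fixed $c\in\{1,-1\}$ there is $m$ such that $x^n-b\,y_1^{k_1}\cdots y_\ell^{k_\ell}\equiv c\pmod m$ and $x^n-b\,y_1^{k_1}\cdots y_\ell^{k_\ell}=c$ have the same non-negative integer solutions.)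
   Context: Convention: $0^0=0$ (so, e.g., $x^0=0$ when $x=0$ and $y_i^{0}=0$ when $y_i=0$); all other powers have their usual meaning. *)

(* Defs.v *)
From mathcomp Require Import all_boot all_order all_algebra.

Set Implicit Arguments.
Unset Strict Implicit.
Unset Printing Implicit Defensive.

Import Order.TTheory GRing.Theory Num.Theory.
Local Open Scope ring_scope.

(* Integer powers under the convention 0 ^ 0 = 0 (MathComp has 0 ^+ 0 = 1). *)
Definition powz0 (x : int) (n : nat) : int :=
  if (x == 0) && (n == 0)%N then 0 else x ^+ n.

(* For l = 0 the product is empty, so the value is powz0 x n - b. *)
Definition expdiff (l : nat) (b x : int) (y : 'I_l -> int)
    (n : nat) (k : 'I_l -> nat) : int :=
  powz0 x n - b * \prod_(i < l) powz0 (y i) (k i).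

(* Main.v *)
Require Import Defs.
From Stdlib Require Import Classical.
From mathcomp Require Import all_boot all_order all_algebra.
From mathcomp Require Import zify ring.

Set Implicit Arguments.
Unset Strict Implicit.
Unset Printing Implicit Defensive.

Import Order.TTheory GRing.Theory Num.Theory.
Local Open Scope ring_scope.

(* Write z for b y_1^k_1 ... y_l^k_l and suppose b and all y_i are nonzero, so
   that every prime factor of z divides one fixed Y > 0. For |x| > 1 and each
   prime p, a suitable modulus forces the p-part of z to be bounded: if a high
   power of p divides z, then it divides x^n - c, so n is an (odd, if c = -1)
   multiple of n0 p^j, where n0 > 0 is the least exponent with p^3 | x^n0 - c
   and j is as large as desired. With w = c x^n0, the number w^(p^j) - 1 gains
   a new prime factor at each step in j, hence eventually has a prime factor r
   not dividing Y; then r divides x^n - c, and with r in the modulus it divides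
   z, a contradiction. (If p = 2 and c = -1, no high power of 2 divides x^n + 1;
   if no such n0 exists, then n = 0.) So z takes finitely many values, and x^n = c + z modulo
   a high power of x, times a prime not dividing x, forces n to be bounded. A
   further large factor of the modulus turns the congruence into an equality. *)

(** * Powers of a prime dividing [w ^+ s - 1] *)

Lemma dvdz_geom_sum_sub (d w : int) (s : nat) :
  (d %| w - 1)%Z -> (d %| \sum_(i < s) w ^+ i - s%:Z)%Z.
Proof.
move=> dw.
have -> : s%:Z = \sum_(i < s) 1 by rewrite sumr_const card_ord natz.
rewrite -sumrB; apply: rpred_sum => i _.
by rewrite subrX1 dvdz_mulr.
Qed.

(** The cofactor [\sum_(i < s) w ^+ i] is congruent to [s] modulo [p], hence prime to [p]. *)
Lemma dvdz_sub1_of_exp (p K s : nat) (w : int) :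
  prime p -> (p %| w - 1)%Z -> ~~ (p %| s)%N ->
  ((p ^ K)%N %| w ^+ s - 1)%Z -> ((p ^ K)%N %| w - 1)%Z.
Proof.
move=> pp pw ps; rewrite subrX1 Gauss_dvdzl //.
rewrite /coprimez -[_ == 1]/(coprime `|_|%N `|_|%N) absz_nat coprimeXl //.
rewrite prime_coprime //; apply: contra ps => pS.
have pS' : (p %| \sum_(i < s) w ^+ i)%Z by rewrite dvdzE.
by have := dvdz_geom_sum_sub s pw; rewrite rpredBl // dvdzE.
Qed.

(** Induction on [j]: if [s = s' * p ^ j] with [s'] prime to [p], the whole power of [p] would
    divide the nonzero number [w ^+ (p ^ j) - 1]. Raising the exponent by the size [a] of that
    number excludes this, since [a < p ^ a]. *)
Lemma dvdn_exponent_of_dvdz (p j : nat) (w : int) :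
  prime p -> (p %| w - 1)%Z -> (1 < `|w|)%N ->
  exists K : nat, forall s : nat,
    ((p ^ K)%N %| w ^+ s - 1)%Z -> (p ^ j %| s)%N.
Proof.
move=> pp pw w1; elim: j => [|j [K HK]]; first by exists 0%N.
pose w' := w ^+ (p ^ j).
have w'1 : w' - 1 != 0.
  rewrite subr_eq0; apply/eqP => /(congr1 absz); rewrite abszX => /eqP.
  by rewrite -[X in _ == X](expn0 `|w|%N) eqn_exp2l // expn_eq0; case: (p) pp.
exists (K + `|w' - 1|)%N => s Hs.
have /dvdnP[s' Es] : (p ^ j %| s)%N.
  by apply: HK; apply: dvdz_trans Hs; rewrite expnD PoszM dvdz_mulr.
rewrite Es mulnC expnSr dvdn_pmul2l ?expn_gt0 ?prime_gt0 //.
apply: contraT => ps.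
have pw' : (p %| w' - 1)%Z by rewrite /w' subrX1 dvdz_mulr.
have : ((p ^ `|w' - 1|)%N %| w' - 1)%Z.
  apply: (dvdz_sub1_of_exp pp pw' ps).
  by rewrite -exprM mulnC -Es; apply: dvdz_trans Hs; rewrite expnD PoszM dvdz_mull.
rewrite dvdzE absz_nat => /dvdn_leq; rewrite absz_gt0 => /(_ w'1).
by rewrite leqNgt ltn_expl // prime_gt1.
Qed.

(** * New prime factors along the tower [w ^+ (p ^ j) - 1] *)

Lemma new_prime_divisor (p : nat) (w : int) :
  prime p -> ((p ^ 3)%N %| w - 1)%Z -> (1 < `|w|)%N ->
  exists r : nat, [/\ prime r, (r %| w ^+ p - 1)%Z & ~~ (r %| w - 1)%Z].
Proof.
move=> pp pw w1; have p1 := prime_gt1 pp.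
pose Q := \sum_(i < p) w ^+ i.
have EQ : w ^+ p - 1 = (w - 1) * Q by rewrite subrX1.
have w0 : w - 1 != 0 by clear -w1; lia.
have wge : (p ^ 3 <= `|w - 1|)%N by apply: dvdn_leq; rewrite ?absz_gt0.
(* The cube gives [|w| + 1 >= p ^ 3 >= 2 * p + 2], while [|Q| >= |w| - 1]. *)
have Qgt : (p < `|Q|)%N.
  have h7 : (p + p + 2 <= p ^ 3)%N.
    have : (2 ^ 2 * p <= p ^ 3)%N by rewrite (expnSr p) leq_mul2r leq_exp2r ?p1 ?orbT.
    by clear -p1; move: (p ^ 3)%N => P; lia.
  have w2 : (`|w| ^ 2 <= `|w ^+ p|)%N by rewrite abszX leq_exp2l.
  have h2 : ((`|w| - 1) * (`|w| + 1) <= `|w - 1| * `|Q|)%N.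
    rewrite -abszM -EQ -subn_sqr exp1n.
    by clear -w2; move: (w ^+ p) (`|w| ^ 2)%N w2 => u v; lia.
  have h5 : (`|w - 1| <= `|w| + 1)%N by clear; lia.
  have h6 : (`|w| - 1 <= `|Q|)%N.
    have : (`|w - 1| * `|Q| <= (`|w| + 1) * `|Q|)%N by rewrite leq_mul2r h5 orbT.
    by move/(leq_trans h2); rewrite mulnC leq_pmul2l ?addn1.
  clear -p1 h5 h6 h7 wge; move: (p ^ 3)%N h7 wge h5 h6 => P; lia.
(* As [Q = p %[mod p ^ 2]], the cofactor of [p] in [Q] is prime to [p], while
   a common prime factor of [Q] and [w - 1] must be [p]. *)
have pQ : ((p ^ 2)%N %| Q - p%:Z)%Z.
  by apply: dvdz_geom_sum_sub; apply: dvdz_trans pw; rewrite expnSr PoszM dvdz_mulr.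
have /dvdzP[t Et] := pQ.
have {}Et : Q = p%:Z * (1 + t * p%:Z).
  by rewrite -[LHS](subrK p%:Z) Et expnS expn1 PoszM; ring.
have R1 : (1 < `|(1 + t * p%:Z)%R|)%N.
  by move: Qgt; rewrite Et abszM absz_nat -[X in (X < _)%N]muln1 ltn_pmul2l ?prime_gt0.
have pr := pdiv_prime R1; have dr := pdiv_dvd `|(1 + t * p%:Z)%R|%N.
set r := pdiv _ in pr dr.
exists r; split=> //.
  by rewrite EQ Et dvdzE !abszM !dvdn_mull.
apply/negP => rw.
have rQ : (r %| Q)%Z by rewrite Et dvdz_mull // dvdzE.
have := dvdz_geom_sum_sub p rw; rewrite -/Q rpredBl // dvdzE !absz_nat.
rewrite dvdn_prime2 // => /eqP rp.
have : (p %| 1 + t * p%:Z)%Z by rewrite dvdzE absz_nat -{1}rp.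
by rewrite rpredDr ?dvdz_mull // dvdzE dvdn1 eqn_leq leqNgt p1.
Qed.

Lemma size_primes_tower (p j : nat) (w : int) :
  prime p -> ((p ^ 3)%N %| w - 1)%Z -> (1 < `|w|)%N ->
  (j <= size (primes `|w ^+ (p ^ j) - 1|))%N.
Proof.
move=> pp pw w1; elim: j => [//|j IHj].
have p0 := prime_gt0 pp.
have w1' k : (1 < `|w ^+ (p ^ k)|)%N.
  by rewrite abszX -(exp1n (p ^ k)) ltn_exp2r // expn_gt0 p0.
have pw' : ((p ^ 3)%N %| w ^+ (p ^ j) - 1)%Z by rewrite subrX1 dvdz_mulr.
have [r [pr rd rn]] := new_prime_divisor pp pw' (w1' j).
rewrite -exprM -expnSr in rd.
apply: leq_ltn_trans IHj _.
apply: (@leq_trans (size (r :: primes `|w ^+ (p ^ j) - 1|))) => //.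
apply: uniq_leq_size => [|q].
  rewrite cons_uniq primes_uniq andbT mem_primes.
  by apply: contra rn => /and3P[].
have nz : (0 < `|w ^+ (p ^ j.+1) - 1|)%N.
  by clear -w1'; move: (w ^+ (p ^ j.+1)) (w1' j.+1) => u; lia.
rewrite inE => /orP[/eqP->|]; first by rewrite mem_primes pr nz.
rewrite !mem_primes => /and3P[-> _ qd]; rewrite nz /=.
by apply: dvdn_trans qd _; rewrite expnSr exprM [X in (_ %| absz X)%N]subrX1 abszM dvdn_mulr.
Qed.

(** Pigeonhole: at height [j] there are at least [j] primes, more than [Y] has. *)
Lemma prime_divisor_outside (p Y : nat) (w : int) :
  prime p -> ((p ^ 3)%N %| w - 1)%Z -> (1 < `|w|)%N -> (0 < Y)%N ->
  exists j r : nat, [/\ prime r, (r %| w ^+ (p ^ j) - 1)%Z & ~~ (r %| Y)%N].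
Proof.
move=> pp pw w1 Y0; pose j := (size (primes Y)).+1.
have [/allP sub|/allPn[r]] := boolP (all (mem (primes Y)) (primes `|w ^+ (p ^ j) - 1|)).
  have := leq_trans (size_primes_tower j pp pw w1) (uniq_leq_size (primes_uniq _) sub).
  by rewrite ltnn.
rewrite mem_primes => /and3P[pr _ rd] /=; rewrite mem_primes pr Y0 /= => rY.
by exists j, r.
Qed.

(** * Bounding the power of one prime in [z] *)

(** Write [n = n0 * q + t], so [c ^+ q * x ^+ t] is [c] modulo [d]. If [c ^+ q = c], then [x ^+ t]
    is 1 and a positive [t] would make [n0 - t] a smaller exponent. Otherwise [c = -1] and
    [c ^+ q = 1]; minimality gives [t = 0], so [d] divides 2. *)
Lemma least_exponent_divides (d n0 n : nat) (x c : int) :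
  c = 1 \/ c = -1 /\ ~~ (d %| 2)%N ->
  (0 < n0)%N -> (d %| x ^+ n0 - c)%Z ->
  (forall k : nat, (0 < k < n0)%N -> ~~ (d %| x ^+ k - c)%Z) ->
  (d %| x ^+ n - c)%Z -> exists2 s : nat, n = (n0 * s)%N & c ^+ s = c.
Proof.
move=> hc n00 dn0 min dn.
pose q := (n %/ n0)%N; pose t := (n %% n0)%N.
have En : n = (n0 * q + t)%N by rewrite mulnC -divn_eq.
have tn : (t < n0)%N by rewrite ltn_mod.
have c2 : c * c = 1 by case: hc => [->|[-> _]].
have dq : (d %| x ^+ (n0 * q) - c ^+ q)%Z by rewrite exprM subrXX dvdz_mulr.
have dt : (d %| c ^+ q * x ^+ t - c)%Z.
  have -> : c ^+ q * x ^+ t - c =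
      (x ^+ n - c) - (x ^+ (n0 * q) - c ^+ q) * x ^+ t by rewrite En exprD; ring.
  by rewrite rpredB // dvdz_mulr.
have t0_of : (d %| x ^+ t - c)%Z -> t = 0%N.
  move=> h; apply/eqP; apply: contraT; rewrite -lt0n => t0.
  by have := min t; rewrite t0 tn h => /(_ isT).
have [ceq|cne] := eqVneq (c ^+ q) c.
  have dt1 : (d %| x ^+ t - 1)%Z.
    have -> : x ^+ t - 1 = c * (c ^+ q * x ^+ t - c).
      by rewrite ceq mulrBr mulrA c2 mul1r.
    by rewrite dvdz_mull.
  exists q => //; rewrite En; suff -> : t = 0%N by rewrite addn0.
  apply/eqP; apply: contraT; rewrite -lt0n => t0.
  have := min (n0 - t)%N; rewrite subn_gt0 tn ltn_subrL t0 n00 => /(_ isT).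
  have -> : x ^+ (n0 - t) - c = (x ^+ n0 - c) - (x ^+ t - 1) * x ^+ (n0 - t).
    by rewrite -{2}(subnK (ltnW tn)) exprD; ring.
  by rewrite rpredB // dvdz_mulr.
case: hc => [c1|[cN d2]]; first by rewrite c1 expr1n eqxx in cne.
have cq : c ^+ q = 1.
  by move: cne; rewrite cN -signr_odd; case: (odd q); rewrite ?expr1 ?eqxx.
move: dt; rewrite cq mul1r => dt; have t0 := t0_of dt.
by move: dt; rewrite t0 cN expr0 opprK dvdzE absz_nat (negPf d2).
Qed.

(* In particular [supported Y 0] fails for [Y > 0]. *)
Definition supported (Y : nat) (z : int) : Prop :=
  forall r : nat, prime r -> (r %| z)%Z -> (r %| Y)%N.

Lemma prime_not_dividing (Y : nat) :
  (0 < Y)%N -> exists2 r : nat, prime r & ~~ (r %| Y)%N.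
Proof.
move=> Y0; have [r Yr pr] := prime_above Y.
by exists r => //; rewrite gtnNdvd.
Qed.

(** For even [n], [x ^+ n + 1] is 1 or 2 modulo 4. For odd [n], it is [- ((- x) ^+ n - 1)], so
    [2 ^ K] would divide the smaller nonzero number [x + 1]. *)
Lemma pow2_not_dvd_exp_add1 (x : int) (K n : nat) :
  (1 < `|x|)%N -> (1 < K)%N -> (`|(x + 1)%R| < 2 ^ K)%N ->
  ~~ ((2 ^ K)%N %| x ^+ n + 1)%Z.
Proof.
move=> x1 K1 xK; apply/negP => d.
have d4 : (4 %| x ^+ n + 1)%Z.
  apply: dvdz_trans d; rewrite -[K](subnK K1) expnD PoszM.
  exact: dvdz_mull.
have [En|On] := boolP (odd n); last first.
  move: d4; rewrite -[n]odd_double_half (negPf On) add0n -muln2 exprM.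
  move: (x ^+ _) => u; clear => h.
  have [a [e [E [e0|e0]]]] : exists a e : int, u = a * 2 + e /\ (e = 0 \/ e = 1).
    by exists (u %/ 2)%Z, (u %% 2)%Z; lia.
  - move: h; rewrite E e0 => /dvdzP[q]; rewrite addr0 exprMn => h; lia.
  - move: h; rewrite E e0 => /dvdzP[q].
    rewrite (_ : _ + 1 = 4 * (a * a + a) + 2); last by ring.
    by move: (a * a + a) => v; lia.
have Ex : (- x) ^+ n - 1 = - (x ^+ n + 1).
  by rewrite exprNn -signr_odd En expr1; ring.
have d2 : (2 %| - x - 1)%Z.
  have /dvdzP[q Eq] : (2 %| x ^+ n + 1)%Z by apply: dvdz_trans d4.
  have : ~~ (2 %| x ^+ n)%Z.
    by apply/negP => /dvdzP[q']; move: Eq; move: (x ^+ n) => u; lia.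
  apply: contraR => h; have {}h : (2 %| x)%Z by lia.
  by case: (n) En => // n' _; rewrite exprS dvdz_mulr.
have : ((2 ^ K)%N %| - x - 1)%Z.
  apply: (@dvdz_sub1_of_exp 2 K n) => //; first by rewrite dvdn2 En.
  by rewrite Ex rpredN.
rewrite -opprD rpredN dvdzE absz_nat => /dvdn_leq h.
by move: xK; rewrite ltnNge h //; clear -x1; lia.
Qed.

Lemma prime_power_obstruction (p Y : nat) (x c : int) :
  prime p -> (1 < `|x|)%N -> (0 < Y)%N -> c = 1 \/ c = -1 ->
  exists K m : nat, (0 < m)%N /\ forall (n : nat) (z : int),
    supported Y z -> (m %| x ^+ n - c - z)%Z -> ~~ ((p ^ K)%N %| z)%Z.
Proof.
move=> pp x1 Y0 hc; have p0 := prime_gt0 pp; have p1 := prime_gt1 pp.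
have [[p2 cN]|hc'] : (p = 2%N /\ c = -1) \/ (c = 1 \/ c = -1 /\ ~~ (p ^ 3 %| 2)%N).
  have [p2|p2] := eqVneq p 2%N; last first.
    right; case: hc => ->; [by left | right; split=> //].
    apply: contra p2 => h; rewrite -dvdn_prime2 //.
    by apply: dvdn_trans h; rewrite dvdn_exp.
  by case: hc => ->; [right; left | left].
- rewrite p2 cN; exists (`|(x + 1)%R| + 2)%N, (2 ^ (`|(x + 1)%R| + 2))%N.
  split=> [|n z _ d]; first by rewrite expn_gt0.
  have : ~~ ((2 ^ (`|(x + 1)%R| + 2))%N %| x ^+ n + 1)%Z.
    apply: pow2_not_dvd_exp_add1 => //; first by rewrite addn2.
    by apply: leq_trans (ltn_expl _ (ltnSn 1)) _; rewrite leq_exp2l // leq_addr.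
  by apply: contra => dz; rewrite -[X in (_ %| X)%Z](subrK z) rpredD //.
have c2 : c * c = 1 by case: hc => ->.
case: (classic (exists n, (0 < n)%N && ((p ^ 3)%N %| x ^+ n - c)%Z)) => [ex|nex].
- case: (ex_minnP ex) => n0 /andP[n00 dn0] min.
  (* As [c * c = 1], [w] is 1 modulo [p ^ 3], and [w ^+ s - 1] equals [c * (x ^+ n - c)] when
     [n = n0 * s] and [c ^+ s = c]. *)
  pose w := c * x ^+ n0.
  have w1 : (1 < `|w|)%N.
    rewrite abszM abszX (_ : `|c|%N = 1%N) ?mul1n; last by case: hc => ->.
    by rewrite -(exp1n n0) ltn_exp2r.
  have pw : ((p ^ 3)%N %| w - 1)%Z.
    have -> : w - 1 = c * (x ^+ n0 - c) by rewrite mulrBr c2.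
    exact: dvdz_mull.
  have pw' : (p %| w - 1)%Z.
    by apply: dvdz_trans pw; rewrite expnS PoszM dvdz_mulr.
  have [j [r [pr rd rY]]] := prime_divisor_outside pp pw w1 Y0.
  have [K HK] := dvdn_exponent_of_dvdz j pp pw' w1.
  exists (K + 3)%N, (p ^ (K + 3) * r)%N.
  split=> [|n z sz d]; first by rewrite muln_gt0 expn_gt0 p0 prime_gt0.
  apply/negP => dz.
  have dn : ((p ^ (K + 3))%N %| x ^+ n - c)%Z.
    rewrite -[X in (_ %| X)%Z](subrK z) rpredD //.
    by apply: dvdz_trans d; rewrite PoszM dvdz_mulr.
  have [||s En cs] := @least_exponent_divides (p ^ 3) n0 n x c hc' n00 dn0.
  + move=> k /andP[k0 kn]; apply: contraL kn => dk.
    by rewrite -leqNgt min // k0.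
  + by apply: dvdz_trans dn; rewrite expnD PoszM dvdz_mull.
  have Ew : w ^+ s - 1 = c * (x ^+ n - c).
    by rewrite /w exprMn cs -exprM -En mulrBr c2.
  have /dvdnP[t Et] : (p ^ j %| s)%N.
    apply: HK; rewrite Ew dvdz_mull //.
    by apply: dvdz_trans dn; rewrite expnD PoszM dvdz_mulr.
  have rn : (r %| x ^+ n - c)%Z.
    have -> : x ^+ n - c = c * (w ^+ s - 1) by rewrite Ew mulrA c2 mul1r.
    by rewrite dvdz_mull // Et mulnC exprM subrX1 dvdz_mulr.
  move/negP: rY; apply; apply: sz => //.
  rewrite -[z](subKr (x ^+ n - c)) rpredB //.
  by apply: dvdz_trans d; rewrite PoszM dvdz_mull.
(* Now [n = 0] is forced. For [c = 1], [x ^+ n - c] vanishes and [r] divides [z]; for [c = -1],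
   [p ^ 3] would divide 2. *)
have [r pr rY] := prime_not_dividing Y0.
exists 3%N, (p ^ 3 * r)%N.
split=> [|n z sz d]; first by rewrite muln_gt0 expn_gt0 p0 prime_gt0.
apply/negP => dz.
have dn : ((p ^ 3)%N %| x ^+ n - c)%Z.
  rewrite -[X in (_ %| X)%Z](subrK z) rpredD //.
  by apply: dvdz_trans d; rewrite PoszM dvdz_mulr.
have n0 : n = 0%N.
  apply/eqP; apply: contraT; rewrite -lt0n => n0.
  by case: nex; exists n; rewrite n0.
case: hc' => [c1|[cN p2]].
  move/negP: rY; apply; apply: sz => //.
  rewrite -[z]opprK -[- z]add0r -[X in X - z](subrr c) {1}c1 -(expr0 x) -n0 rpredN.
  by apply: dvdz_trans d; rewrite PoszM dvdz_mull.
by move: dn; rewrite n0 cN expr0 opprK dvdzE absz_nat (negPf p2).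
Qed.

(** * From bounded prime powers to equality *)

(** Only the finitely many primes of [Y] matter: multiplying their moduli and adding their exponents
    yields one [K] for which [z] divides [Y ^ K]. *)
Lemma supported_bounded (I : Type) (e : I -> int) (Y : nat) :
  (0 < Y)%N ->
  (forall p : nat, prime p ->
     exists K m : nat, (0 < m)%N /\ forall (i : I) (z : int),
       supported Y z -> (m %| e i - z)%Z -> ~~ ((p ^ K)%N %| z)%Z) ->
  exists m B : nat, (0 < m)%N /\ forall (i : I) (z : int),
    supported Y z -> (m %| e i - z)%Z -> (`|z| <= B)%N.
Proof.
move=> Y0 H.
have H' (s : seq nat) : all prime s ->
    exists K m : nat, (0 < m)%N /\ forall (i : I) (z : int), supported Y z ->
      (m %| e i - z)%Z -> forall p, p \in s -> ~~ ((p ^ K)%N %| z)%Z.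
  elim: s => [|p s IHs] /=; first by exists 0%N, 1%N.
  case/andP=> pp /IHs[K [m [m0 Km]]]; have [K' [m' [m'0 Km']]] := H p pp.
  exists (K + K')%N, (m * m')%N; split=> [|i z sz d q]; first by rewrite muln_gt0 m0.
  rewrite inE => /orP[/eqP->|qs].
    have := Km' i z sz; rewrite (dvdz_trans _ d) ?PoszM ?dvdz_mull // => /(_ isT).
    by apply: contra; apply: dvdz_trans; rewrite expnD PoszM dvdz_mull.
  have := Km i z sz; rewrite (dvdz_trans _ d) ?PoszM ?dvdz_mulr // => /(_ isT q qs).
  by apply: contra; apply: dvdz_trans; rewrite expnD PoszM dvdz_mulr.
have [|K [m [m0 Km]]] := H' (primes Y).
  by apply/allP => p; rewrite mem_primes => /andP[].
exists m, (Y ^ K)%N; split=> // i z sz d.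
have z0 : (0 < `|z|)%N.
  rewrite absz_gt0; apply/eqP => z0; have [r pr] := prime_not_dividing Y0.
  by rewrite sz // z0 dvdz0.
apply: dvdn_leq; first by rewrite expn_gt0 Y0.
apply/dvdn_partP => // p; rewrite mem_primes => /and3P[pp _ pz].
have pY : (p %| Y)%N by apply: sz.
rewrite p_part; apply: (@dvdn_trans (p ^ K)); last exact: dvdn_exp2r.
apply: dvdn_exp2l; apply: ltnW.
have := Km i z sz d p; rewrite mem_primes pp Y0 pY => /(_ isT).
by rewrite dvdzE absz_nat pfactor_dvdn // -ltnNge.
Qed.

(** Choose [|x| ^ L > B]. For [n >= L], the factor [|x| ^ L] forces [u = 0], which the prime [q] not
    dividing [x] excludes. For [n < L], [M] exceeds [|x ^+ n - u|]. *)
Lemma power_eq_bounded (x : int) (B : nat) : (1 < `|x|)%N ->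
  exists m : nat, (0 < m)%N /\ forall (n : nat) (u : int),
    (`|u| <= B)%N -> (m %| x ^+ n - u)%Z -> x ^+ n = u.
Proof.
move=> x1; pose L := B.+1.
have x0 : (0 < `|x|)%N by apply: ltnW.
have BL : (B < `|x| ^ L)%N by apply: leq_trans (ltn_expl L x1).
have [q pq qx] := prime_not_dividing x0.
pose M := (`|x| ^ L + B).+1.
exists (`|x| ^ L * q * M)%N; split=> [|n u uB d].
  by rewrite !muln_gt0 expn_gt0 x0 prime_gt0.
have [Ln|nL] := leqP L n; last first.
  have {}d : (M %| x ^+ n - u)%Z by apply: dvdz_trans d; rewrite PoszM dvdz_mull.
  apply/eqP; rewrite -subr_eq0; apply: contraT => ne.
  move: d; rewrite dvdzE absz_nat => /dvdn_leq; rewrite absz_gt0 => /(_ ne).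
  have : (`|x ^+ n| <= `|x| ^ L)%N by rewrite abszX leq_exp2l // ltnW.
  rewrite /M; move: uB; clear; move: (x ^+ n) (`|x| ^ L)%N => v P; lia.
have u0 : u = 0.
  have : (`|x| ^ L %| `|u|)%N.
    rewrite -[u](subKr (x ^+ n)).
    have : ((`|x| ^ L)%N %| x ^+ n - (x ^+ n - u))%Z.
      rewrite rpredB //; first by rewrite dvdzE abszX absz_nat dvdn_exp2l.
      by apply: dvdz_trans d; rewrite -mulnA PoszM dvdz_mulr.
    by rewrite dvdzE absz_nat.
  apply: contraPeq => ne /dvdn_leq; rewrite absz_gt0 => /(_ ne).
  by rewrite leqNgt (leq_ltn_trans uB BL).
have : (q %| x ^+ n - u)%Z.
  by apply: dvdz_trans d; rewrite mulnAC PoszM dvdz_mull.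
by rewrite u0 subr0 dvdzE abszX absz_nat Euclid_dvdX // (negPf qx).
Qed.

(** * The convention [0 ^ 0 = 0] and the final assembly *)

Lemma powz0_nz (x : int) (n : nat) : x != 0 -> powz0 x n = x ^+ n.
Proof. by rewrite /powz0 => /negPf->. Qed.

Lemma powz00 (n : nat) : powz0 0 n = 0.
Proof. by rewrite /powz0 eqxx; case: n => //= n; rewrite expr0n. Qed.

Lemma absz_powz0_le1 (x : int) (n : nat) : (`|x| <= 1)%N -> (`|powz0 x n| <= 1)%N.
Proof.
move=> x1; have [->|x0] := eqVneq x 0; first by rewrite powz00.
rewrite powz0_nz // abszX (_ : `|x|%N = 1%N) ?exp1n //.
by apply/eqP; rewrite eqn_leq x1 absz_gt0.
Qed.

(** By the convention, a zero [y i] kills the product even at exponent 0. *)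
Lemma monomial_zero_or_supported (l : nat) (b : int) (y : 'I_l -> int) :
  (forall k : 'I_l -> nat, b * \prod_(i < l) powz0 (y i) (k i) = 0) \/
  exists2 Y : nat, (0 < Y)%N &
    forall k : 'I_l -> nat, supported Y (b * \prod_(i < l) powz0 (y i) (k i)).
Proof.
have [b0|b0] := eqVneq b 0; first by left=> k; rewrite b0 mul0r.
have [/existsP[i /eqP yi0]|/existsPn y0] := boolP [exists i, y i == 0].
  by left=> k; rewrite (bigD1 i) //= yi0 powz00 mul0r mulr0.
right; exists `|(b * \prod_(i < l) y i)%R|%N.
  by rewrite absz_gt0 mulf_neq0 //; apply/prodf_neq0 => i _.
move=> k r pr; rewrite dvdzE !abszM absz_nat !Euclid_dvdM // => /orP[->//|h].
apply/orP; right; elim/big_rec2: _ h => [|i u v _ IH]; first by rewrite dvdn1.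
rewrite !abszM !Euclid_dvdM // powz0_nz ?y0 // abszX Euclid_dvdX //.
by case/orP=> [/andP[->]|/IH->]; rewrite ?orbT.
Qed.

Lemma expdiff_congruence (l : nat) (b x c : int) (y : 'I_l -> int) :
  c = 1 \/ c = -1 ->
  exists m : nat, (0 < m)%N /\ forall (n : nat) (k : 'I_l -> nat),
    (m %| expdiff b x y n k - c)%Z -> expdiff b x y n k = c.
Proof.
move=> hc; pose z (k : 'I_l -> nat) := b * \prod_(i < l) powz0 (y i) (k i).
have c1 : `|c|%N = 1%N by case: hc => ->.
have Ex n k : expdiff b x y n k = powz0 x n - z k by [].
have [m [B [m0 HB]]] : exists m B : nat, (0 < m)%N /\ forall n k,
    (m %| powz0 x n - c - z k)%Z -> (`|z k| <= B)%N.
  case: (monomial_zero_or_supported b y) => [z0|[Y Y0 sz]].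
    by exists 1%N, 0%N; split=> // n k _; rewrite /z z0.
  suff [m [B [m0 HB]]] : exists m B : nat, (0 < m)%N /\ forall n u,
      supported Y u -> (m %| powz0 x n - c - u)%Z -> (`|u| <= B)%N.
    by exists m, B; split=> // n k; apply/HB/sz.
  apply: supported_bounded => // p pp.
  have [x1|x1] := ltnP 1 `|x|.
    have x0 : x != 0 by apply: contraTneq x1 => ->.
    have [K [m [m0 Hm]]] := prime_power_obstruction pp x1 Y0 hc.
    by exists K, m; split=> // n; rewrite powz0_nz //; apply: Hm.
  (* For [|x| <= 1], [|a - c| <= 2 < p ^ 2], so [p ^ 2] dividing [u] forces [a = c], and then [r]
     divides [u]. *)
  have [r pr rY] := prime_not_dividing Y0.
  exists 2%N, (p ^ 2 * r)%N; split=> [|n u su d].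
    by rewrite muln_gt0 expn_gt0 !prime_gt0.
  apply/negP => du; have := absz_powz0_le1 n x1.
  move: (powz0 x n) d => a d a1.
  have da : ((p ^ 2)%N %| a - c)%Z.
    rewrite -[X in (_ %| X)%Z](subrK u) rpredD //.
    by apply: dvdz_trans d; rewrite PoszM dvdz_mulr.
  have a0 : a - c = 0.
    apply/eqP; apply: contraT => ne; move: da; rewrite dvdzE absz_nat => /dvdn_leq.
    rewrite absz_gt0 => /(_ ne) h.
    have : (2 ^ 2 <= p ^ 2)%N by rewrite leq_exp2r ?prime_gt1.
    by move: h a1 c1; clear; move: (p ^ 2)%N => P; lia.
  move/negP: rY; apply; apply: su => //.
  by move: d; rewrite a0 sub0r rpredN; apply: dvdz_trans; rewrite PoszM dvdz_mull.
have Em n k : expdiff b x y n k - c = powz0 x n - c - z k by rewrite Ex; ring.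
have [x1|x1] := ltnP 1 `|x|.
  have x0 : x != 0 by apply: contraTneq x1 => ->.
  (* The power is compared with [c + z k], of size at most [B + 1]. *)
  have [m' [m'0 Hm']] := power_eq_bounded B.+1 x1.
  exists (m * m')%N; split=> [|n k d]; first by rewrite muln_gt0 m0.
  have zB : (`|z k| <= B)%N.
    by apply: (HB n); rewrite -Em; apply: dvdz_trans d; rewrite PoszM dvdz_mulr.
  rewrite Ex powz0_nz // (Hm' n (c + z k)); first by ring.
    by move: zB c1; clear; lia.
  rewrite opprD addrA -(powz0_nz n x0) -Em.
  by apply: dvdz_trans d; rewrite PoszM dvdz_mull.
(* Here [|powz0 x n - c - z k| <= B + 2]. *)
exists (m * B.+3)%N; split=> [|n k d]; first by rewrite muln_gt0 m0.
have zB : (`|z k| <= B)%N.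
  by apply: (HB n); rewrite -Em; apply: dvdz_trans d; rewrite PoszM dvdz_mulr.
have {}d : (B.+3 %| expdiff b x y n k - c)%Z.
  by apply: dvdz_trans d; rewrite PoszM dvdz_mull.
apply/eqP; rewrite -subr_eq0; apply: contraT => ne; move: d.
rewrite dvdzE absz_nat => /dvdn_leq; rewrite absz_gt0 => /(_ ne).
have := absz_powz0_le1 n x1; move: zB c1; rewrite Em; clear.
by move: (powz0 x n) (z k) => a u; lia.
Qed.

Theorem theorem1 (l : nat) (b x : int) (y : 'I_l -> int) :
  (exists m : int, 0 < m /\
     forall (n : nat) (k : 'I_l -> nat),
       ((expdiff b x y n k = 1 %[mod m])%Z \/
        (expdiff b x y n k = -1 %[mod m])%Z)
       <-> (expdiff b x y n k = 1 \/ expdiff b x y n k = -1))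
  /\
  (forall c : int, c = 1 \/ c = -1 ->
     exists m : int, 0 < m /\
       forall (n : nat) (k : 'I_l -> nat),
         (expdiff b x y n k = c %[mod m])%Z <-> expdiff b x y n k = c).
Proof.
have congr_dvd (u c m d : int) : (u = c %[mod m])%Z -> (d %| m)%Z -> (d %| u - c)%Z.
  by move/eqP; rewrite eqz_mod_dvd => um dm; apply: dvdz_trans um.
split.
  have [m [m0 Hm]] := expdiff_congruence b x y (or_introl (erefl 1)).
  have [m' [m'0 Hm']] := expdiff_congruence b x y (or_intror (erefl (- 1))).
  (* Each sign uses its own factor of the product. *)
  exists (m * m')%N; split; first by rewrite ltz_nat muln_gt0 m0.
  move=> n k; split=> [[d|d]|[->|->]]; [left|right|by left|by right].
    by apply/Hm/(congr_dvd _ _ _ _ d); rewrite PoszM dvdz_mulr.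
  by apply/Hm'/(congr_dvd _ _ _ _ d); rewrite PoszM dvdz_mull.
move=> c hc; have [m [m0 Hm]] := expdiff_congruence b x y hc.
exists m; split=> [|n k]; first by rewrite ltz_nat.
by split=> [d|->//]; apply/Hm/(congr_dvd _ _ _ _ d).
Qed.
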